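(* $V_2=53.1390720$, and this value is attained by the cosine polynomial $f(\phi)=(\cos\phi+\alpha_0)^2\in C_2$ with $\alpha_0= 0.7415574$.
   Context: For an integer $n\ge 2$, $C_n$ denotes the set of real cosine polynomials $f(\phi)=\sum_{k=0}^{n} a_k\cos(k\phi)$ such that (i) all coefficients $a_0,\dots,a_n$ are real and nonnegative, (ii) $a_1>a_0>0$, and (iii) $f(\phi)\ge 0$ for all real $\phi$. For $f\in C_n$ put $v(f)=\dfrac{f(0)-a_0}{(\sqrt{a_1}-\sqrt{a_0})^2}$, and $V_n=\inf_{f\in C_n} v(f)$. Numerical constants are decimal values as given in the paper, to seven decimal places. *)

(* Defs.v *)
From Stdlib Require Import Reals.
From Coquelicot Require Import Coquelicot.
Open Scope R_scope.

(* A cosine polynomial of degree at most n is given by its coefficients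
   a 0, ..., a n; the values of a beyond n are never used. [sum_f_R0 _ n] has the
   n + 1 terms k = 0, ..., n. *)
Definition cos_poly (n : nat) (a : nat -> R) (phi : R) : R :=
  sum_f_R0 (fun k => a k * cos (INR k * phi)) n.

(* The class C_n, for n >= 2. *)
Definition class_C (n : nat) (a : nat -> R) : Prop :=
  (forall k : nat, (k <= n)%nat -> 0 <= a k) /\
  (a 1%nat > a 0%nat /\ a 0%nat > 0) /\
  (forall phi : R, 0 <= cos_poly n a phi).

(* On class_C n the denominator is nonzero, since a 1 > a 0 > 0. *)
Definition v (n : nat) (a : nat -> R) : R :=
  (cos_poly n a 0 - a 0%nat) / (sqrt (a 1%nat) - sqrt (a 0%nat)) ^ 2.

Definition V (n : nat) : Rbar :=
  Glb_Rbar (fun x : R => exists a : nat -> R, class_C n a /\ x = v n a).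

(* x has the seven-place decimal value d: x rounds to d at the seventh decimal. *)
Definition rounds_to_7dp (x d : R) : Prop := Rabs (x - d) < 1 / 2 * / 10 ^ 7.

(* Main.v *)
(** For [f] in [C_2], either the vertex [-a1 / (4 a2)] of [f], seen as a quadratic
    in [cos phi], lies in [-1, 1], and then nonnegativity there gives
    [a0 >= 2 a2 (x ^ 2 + 1/2)] with [x = a1 / (4 a2)], so that [v f >= F x] where
    [F x = (2 x + 1/2) / (sqrt (2 x) - sqrt (x ^ 2 + 1/2)) ^ 2] is the value of [v]
    at [(cos phi + x) ^ 2]; or [a1 > 4 a2], and nonnegativity at [phi = PI] gives
    [a0 > 3/4 a1], which makes [v f] far too large.

    In the variable [u = sqrt (2 x)], the inequality [F x >= F alpha] reads
    [u - sqrt (u ^ 4 / 4 + 1/2) - k sqrt (u ^ 2 + 1/2) <= 0]. Its left side is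
    concave in [u], so it is enough that it vanish to second order at [alpha],
    which is the polynomial equation
    [2 alpha (2 alpha ^ 2 + alpha - 1) ^ 2 = alpha ^ 2 + 1/2]. *)

Require Import Defs.
From Stdlib Require Import Reals Lra Lia.
From Coquelicot Require Import Coquelicot.
Open Scope R_scope.

Definition critical (x : R) : Prop :=
  2 * x * (2 * x ^ 2 + x - 1) ^ 2 = x ^ 2 + 1 / 2.

(* [critical] turns [sqrt (x ^ 2 + 1/2)] into [sqrt (2 x) (2 x ^ 2 + x - 1)], so
   this is the value of [v] at [(cos phi + x) ^ 2]. *)
Definition critical_value (x : R) : R :=
  (2 * x + 1 / 2) / (2 * x * (2 - x - 2 * x ^ 2) ^ 2).

(** A sign change of the critical polynomial. [critical_value] has slope above 2600 here, so fixing
    its seventh decimal takes a much narrower bracket than the seven decimals of the root. *)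
Lemma critical_exists :
  exists x : R, 0.741557387359 <= x <= 0.741557387360 /\ critical x.
Proof.
  destruct (IVT (fun x => 2 * x * (2 * x ^ 2 + x - 1) ^ 2 - (x ^ 2 + 1 / 2))
              0.741557387359 0.741557387360) as [x [Hx Ex]].
  - unfold continuity; intros x; reg.
  - lra.
  - lra.
  - lra.
  - exists x; split; [exact Hx | unfold critical; lra].
Qed.

Lemma critical_value_bounds (x : R) :
  0.741557387359 <= x <= 0.741557387360 ->
  53.13907195 < critical_value x < 53.13907203.
Proof.
  intros Hx; unfold critical_value.
  assert (Hx2 : 0.741557387359 ^ 2 <= x ^ 2 <= 0.741557387360 ^ 2)
    by (split; apply pow_incr; lra).
  set (q := 2 - x - 2 * x ^ 2).
  assert (Hq : 2 - 0.741557387360 - 2 * 0.741557387360 ^ 2 <= q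
               <= 2 - 0.741557387359 - 2 * 0.741557387359 ^ 2)
    by (unfold q; lra).
  assert (Hq2 : (2 - 0.741557387360 - 2 * 0.741557387360 ^ 2) ^ 2 <= q ^ 2
               <= (2 - 0.741557387359 - 2 * 0.741557387359 ^ 2) ^ 2)
    by (split; apply pow_incr; lra).
  assert (Hl : 0.741557387359 * (2 - 0.741557387360 - 2 * 0.741557387360 ^ 2) ^ 2
               <= x * q ^ 2) by (apply Rmult_le_compat; lra).
  assert (Hu : x * q ^ 2 <=
    0.741557387360 * (2 - 0.741557387359 - 2 * 0.741557387359 ^ 2) ^ 2)
    by (apply Rmult_le_compat; lra).
  assert (Hpos : 0 < 2 * x * q ^ 2) by lra.
  split; apply (Rmult_lt_reg_r (2 * x * q ^ 2)); try exact Hpos;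
    unfold Rdiv; rewrite (Rmult_assoc (2 * x + _)), Rinv_l by lra; lra.
Qed.

Lemma sqrt_critical (x : R) :
  0 <= x -> 0 <= 2 * x ^ 2 + x - 1 -> critical x ->
  sqrt (x ^ 2 + 1 / 2) = sqrt (2 * x) * (2 * x ^ 2 + x - 1).
Proof.
  intros Hx Hp Hc; rewrite <- Hc, sqrt_mult by nra.
  now rewrite sqrt_pow2.
Qed.

(** The inequality [F x >= F c] in square-root form, which also covers a negative left side. Both
    roots other than [u] are bounded below by their tangent lines in [u] at [u0]. *)
Lemma critical_optimal (c x : R) :
  0.7 < c < 0.75 -> 0 < 2 * c ^ 2 + c - 1 -> critical c -> 0 <= x ->
  sqrt (2 * x) - sqrt (x ^ 2 + 1 / 2)
    <= sqrt ((2 * x + 1 / 2) / critical_value c).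
Proof.
  intros Hc Hp Ec Hx.
  set (p := 2 * c ^ 2 + c - 1) in *.
  assert (Eq : 2 - c - 2 * c ^ 2 = 1 - p) by (unfold p; ring).
  assert (Hq : 0 < 1 - p) by (unfold p; nra).
  set (u := sqrt (2 * x)); set (u0 := sqrt (2 * c)).
  assert (Hu : 0 <= u) by apply sqrt_pos.
  assert (Hu0 : 0 < u0) by (apply sqrt_lt_R0; lra).
  assert (Eu : u * u = 2 * x) by (apply sqrt_sqrt; lra).
  assert (Eu0 : u0 * u0 = 2 * c) by (apply sqrt_sqrt; lra).
  assert (Ec' : 2 * c * p ^ 2 = c ^ 2 + 1 / 2) by exact Ec.
  (* Cauchy-Schwarz, then [u ^ 2 >= 2 u u0 - u0 ^ 2] *)
  assert (Hw : (c * (2 * (u * u0) - 2 * c) + 1) / (2 * u0 * p)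
               <= sqrt (x ^ 2 + 1 / 2)).
  { apply Rle_trans with ((2 * c * x + 1) / (2 * u0 * p)).
    - apply Rmult_le_compat_r.
      + apply Rlt_le, Rinv_0_lt_compat; nra.
      + pose proof (pow2_ge_0 (u - u0)).
        assert (2 * (u * u0) <= 2 * x + 2 * c) by nra; nra.
    - assert (0 < 2 * u0 * p) by nra.
      assert (0 < (2 * c * x + 1) / (2 * u0 * p))
        by (apply Rdiv_lt_0_compat; nra).
      rewrite <- (sqrt_pow2 ((2 * c * x + 1) / (2 * u0 * p))) by lra.
      apply sqrt_le_1_alt.
      replace (((2 * c * x + 1) / (2 * u0 * p)) ^ 2)
        with ((2 * c * x + 1) ^ 2 / (4 * (2 * c * p ^ 2)))
        by (rewrite <- Eu0; field; lra).
      rewrite Ec'; apply Rle_div_l; [nra |].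
      pose proof (pow2_ge_0 (x - c)); nra. }
  (* Cauchy-Schwarz again: [(u u0 + 1/2)^2 <= (u^2 + 1/2) (u0^2 + 1/2)]. *)
  assert (Hn : u0 * (1 - p) * (u * u0 + 1 / 2) / (2 * c + 1 / 2)
               <= sqrt ((2 * x + 1 / 2) / critical_value c)).
  { assert (0 <= u * u0) by nra.
    assert (0 <= u0 * (1 - p) * (u * u0 + 1 / 2) / (2 * c + 1 / 2)).
    { apply Rdiv_le_0_compat; [| lra].
      apply Rmult_le_pos; [apply Rmult_le_pos |]; lra. }
    rewrite <- (sqrt_pow2 (u0 * (1 - p) * (u * u0 + 1 / 2) / (2 * c + 1 / 2)))
      by assumption.
    apply sqrt_le_1_alt.
    unfold critical_value; rewrite Eq.
    replace ((2 * x + 1 / 2) / ((2 * c + 1 / 2) / (2 * c * (1 - p) ^ 2)))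
      with (2 * c * (1 - p) ^ 2 * ((2 * x + 1 / 2) * (2 * c + 1 / 2))
            / (2 * c + 1 / 2) ^ 2) by (field; lra).
    replace ((u0 * (1 - p) * (u * u0 + 1 / 2) / (2 * c + 1 / 2)) ^ 2)
      with (2 * c * (1 - p) ^ 2 * (u * u0 + 1 / 2) ^ 2 / (2 * c + 1 / 2) ^ 2)
      by (rewrite <- Eu0; field; nra).
    apply Rmult_le_compat_r; [apply Rlt_le, Rinv_0_lt_compat; nra |].
    apply Rmult_le_compat_l; [nra |].
    rewrite <- Eu, <- Eu0; pose proof (pow2_ge_0 (u - u0)); nra. }
  (* The bounds [Hw] and [Hn] are tangent at [u = u0]; as [c] is critical,
     the resulting affine function of [u] is zero. *)
  assert (E : u - (c * (2 * (u * u0) - 2 * c) + 1) / (2 * u0 * p)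
              = u0 * (1 - p) * (u * u0 + 1 / 2) / (2 * c + 1 / 2)).
  (* By [Ec'] both sides equal [4 c^3 + c^2 - 2 c - 1/2]. Since [p - c = 2 c^2 - 1], the two sides
     of [E] are multiples of [u u0 + 1/2], and [E1] matches the factors. *)
  { assert (E1 : 2 * c * p * (1 - p) = (2 * c ^ 2 - 1) * (2 * c + 1 / 2))
      by (unfold p in *; nra).
    apply (Rmult_eq_reg_r (2 * u0 * p * (2 * c + 1 / 2))); [| nra].
    transitivity ((2 * u * u0 * p - (c * (2 * (u * u0) - 2 * c) + 1))
                  * (2 * c + 1 / 2)); [field; nra |].
    transitivity (2 * (u0 * u0) * p * (1 - p) * (u * u0 + 1 / 2));
      [| field; nra].
    rewrite Eu0.
    transitivity (2 * (2 * c * p * (1 - p)) * (u * u0 + 1 / 2)); [| ring].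
    rewrite E1; unfold p; field. }
  lra.
Qed.

Lemma cos_poly_2 (a : nat -> R) (phi : R) :
  cos_poly 2 a phi =
  2 * a 2%nat * cos phi ^ 2 + a 1%nat * cos phi + (a 0%nat - a 2%nat).
Proof.
  unfold cos_poly; simpl sum_f_R0.
  replace (INR 2) with 2 by (simpl; ring).
  rewrite cos_2a_cos; simpl INR.
  rewrite Rmult_0_l, cos_0, Rmult_1_l; ring.
Qed.

Lemma class_C_2_quadratic (a : nat -> R) (y : R) :
  class_C 2 a -> -1 <= y <= 1 ->
  0 <= 2 * a 2%nat * y ^ 2 + a 1%nat * y + (a 0%nat - a 2%nat).
Proof.
  intros [_ [_ H]] Hy; specialize (H (acos y)).
  now rewrite cos_poly_2, cos_acos in H.
Qed.

Lemma v_2_lower_bound (c : R) (a : nat -> R) :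
  0.7 < c < 0.75 -> 0 < 2 * c ^ 2 + c - 1 -> critical c ->
  0 < critical_value c < 55 ->
  class_C 2 a -> critical_value c <= v 2 a.
Proof.
  intros Hc Hp Ec HV Ha.
  pose proof (class_C_2_quadratic a) as Hq.
  pose proof Ha as [Hnn [[H10 H0] _]].
  assert (H2 : 0 <= a 2%nat) by (apply Hnn; lia).
  unfold v; rewrite cos_poly_2, cos_0.
  replace (2 * a 2%nat * 1 ^ 2 + a 1%nat * 1 + (a 0%nat - a 2%nat) - a 0%nat)
    with (a 1%nat + a 2%nat) by ring.
  set (a0 := a 0%nat) in *; set (a1 := a 1%nat) in *; set (a2 := a 2%nat) in *.
  set (m := critical_value c) in *.
  assert (Hst : sqrt a0 < sqrt a1) by (apply sqrt_lt_1_alt; lra).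
  assert (Hd : 0 < (sqrt a1 - sqrt a0) ^ 2) by (apply pow_lt; lra).
  apply (Rle_div_r m _ _ Hd).
  destruct (Rle_or_lt a1 (4 * a2)) as [Hcase | Hcase].
  - assert (Hx1 : a1 / (4 * a2) <= 1) by (apply Rle_div_l; lra).
    assert (Hx0 : 0 < a1 / (4 * a2)) by (apply Rdiv_lt_0_compat; lra).
    set (x := a1 / (4 * a2)) in *.
    assert (Ea1 : a1 = 2 * a2 * (2 * x)) by (unfold x; field; lra).
    assert (Ha0 : 2 * a2 * (x ^ 2 + 1 / 2) <= a0).
    { specialize (Hq (- x) Ha ltac:(lra)); rewrite Ea1 in Hq; nra. }
    pose proof (critical_optimal c x Hc Hp Ec (Rlt_le _ _ Hx0)) as Hopt.
    fold m in Hopt.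
    (* [v] is invariant under scaling of [a], so the common factor [2 a2] is split off both
       roots. *)
    assert (Hs : sqrt a1 = sqrt (2 * a2) * sqrt (2 * x))
      by (rewrite Ea1; apply sqrt_mult; lra).
    assert (Ht : sqrt (2 * a2) * sqrt (x ^ 2 + 1 / 2) <= sqrt a0)
      by (rewrite <- sqrt_mult by nra; now apply sqrt_le_1_alt).
    assert (HN : 0 <= (2 * x + 1 / 2) / m)
      by (apply Rdiv_le_0_compat; lra).
    assert (Hle : sqrt a1 - sqrt a0 <= sqrt (2 * a2 * ((2 * x + 1 / 2) / m))).
    { rewrite (sqrt_mult (2 * a2)) by lra.
      pose proof (sqrt_pos (2 * a2)); nra. }
    assert (Hsq : (sqrt a1 - sqrt a0) ^ 2 <= 2 * a2 * ((2 * x + 1 / 2) / m)).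
    { rewrite <- (pow2_sqrt (2 * a2 * ((2 * x + 1 / 2) / m))) by nra.
      apply pow_incr; lra. }
    apply Rle_trans with (m * (2 * a2 * ((2 * x + 1 / 2) / m))).
    + apply Rmult_le_compat_l; lra.
    + right; rewrite Ea1; field; lra.
  - assert (H34 : 3 / 4 * a1 <= a0) by (specialize (Hq (-1) Ha ltac:(lra)); lra).
    (* [0.866] is just below [sqrt (3/4)]; the bound [m < 55] then suffices, because
       [55 * 0.134^2 < 1]. *)
    assert (Ht : 0.866 * sqrt a1 <= sqrt a0).
    { rewrite <- (sqrt_pow2 0.866), <- sqrt_mult by lra.
      apply sqrt_le_1_alt; lra. }
    assert (Hsq : (sqrt a1 - sqrt a0) ^ 2 <= (0.134 * sqrt a1) ^ 2)
      by (apply pow_incr; lra).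
    rewrite Rpow_mult_distr, pow2_sqrt in Hsq by lra.
    nra.
Qed.

(** From [cos^2 = 1/2 + 1/2 cos (2 phi)], whose constant part joins [x^2]. *)
Definition square_coeffs (x : R) (k : nat) : R :=
  match k with
  | 0%nat => x ^ 2 + 1 / 2
  | 1%nat => 2 * x
  | _ => 1 / 2
  end.

Lemma cos_poly_square_coeffs (x phi : R) :
  cos_poly 2 (square_coeffs x) phi = (cos phi + x) ^ 2.
Proof. rewrite cos_poly_2; simpl; field. Qed.

Lemma class_C_square_coeffs (x : R) :
  0.7 < x < 0.75 -> class_C 2 (square_coeffs x).
Proof.
  intros Hx; repeat split.
  - intros [| [| k]] _; simpl; nra.
  - simpl; nra.
  - simpl; nra.
  - intros phi; rewrite cos_poly_square_coeffs; apply pow2_ge_0.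
Qed.

Lemma v_square_coeffs (x : R) :
  0 < x -> 0 <= 2 * x ^ 2 + x - 1 -> 2 - x - 2 * x ^ 2 <> 0 -> critical x ->
  v 2 (square_coeffs x) = critical_value x.
Proof.
  intros Hx Hp Hq Hc; unfold v, critical_value.
  rewrite cos_poly_2, cos_0; cbn [square_coeffs].
  rewrite sqrt_critical by (assumption || lra).
  replace ((sqrt (2 * x) - sqrt (2 * x) * (2 * x ^ 2 + x - 1)) ^ 2)
    with (sqrt (2 * x) ^ 2 * (2 - x - 2 * x ^ 2) ^ 2) by ring.
  rewrite pow2_sqrt by lra.
  f_equal; field.
Qed.

Theorem theorem2p7 :
  exists V2 : R,
    V 2 = Finite V2 /\
    rounds_to_7dp V2 53.1390720 /\
    exists (alpha0 : R) (a : nat -> R),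
      rounds_to_7dp alpha0 0.7415574 /\
      class_C 2 a /\
      (forall phi : R, cos_poly 2 a phi = (cos phi + alpha0) ^ 2) /\
      v 2 a = V2.
Proof.
  destruct critical_exists as [c [Hc Ec]].
  pose proof (critical_value_bounds c Hc) as HV.
  assert (Hp : 0 < 2 * c ^ 2 + c - 1) by nra.
  assert (Hq : 2 - c - 2 * c ^ 2 <> 0) by nra.
  assert (Hin : class_C 2 (square_coeffs c)) by (apply class_C_square_coeffs; lra).
  assert (Hv : v 2 (square_coeffs c) = critical_value c)
    by (apply v_square_coeffs; assumption || lra).
  exists (critical_value c); split; [| split].
  - apply is_glb_Rbar_unique; split.
    + intros y [a [Ha ->]]; simpl.
      apply v_2_lower_bound; assumption || lra.
    (* The bound is attained, so no lower bound exceeds it. *)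
    + intros b Hb; apply Hb.
      exists (square_coeffs c); split; [exact Hin | now symmetry].
  - apply Rabs_def1; lra.
  - exists c, (square_coeffs c); split; [apply Rabs_def1; lra |].
    split; [exact Hin | split; [apply cos_poly_square_coeffs | exact Hv]].
Qed.
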